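(* Let $m$ be a positive integer, $r\geq 3$, and let $\mathcal{G}$ and $\mathcal{H}$ be $r$-uniform supertrees with $u\in V(\mathcal{G})$ and $v\in V(\mathcal{H})$. Then (i) $\rho\big((\mathcal{G}_u\cdot m\mathcal{H}_v)\cup(m-1)\mathcal{G}\big)=\rho\big((\mathcal{H}_v\cdot m\mathcal{G}_u)\cup(m-1)\mathcal{H}\big)$ and $\rho(\mathcal{G}_u\cdot m\mathcal{H}_v)=\rho(\mathcal{H}_v\cdot m\mathcal{G}_u)$; (ii) $ME\big((\mathcal{G}_u\cdot m\mathcal{H}_v)\cup(m-1)\mathcal{G}\big)=ME\big((\mathcal{H}_v\cdot m\mathcal{G}_u)\cup(m-1)\mathcal{H}\big)$.
   Context: An $r$-uniform supertree is a connected acyclic hypergraph each of whose edges has exactly $r$ vertices. $\cup$ denotes disjoint union and $k\mathcal{G}$ the disjoint union of $k$ copies of $\mathcal{G}$. $\mathcal{G}_u\cdot m\mathcal{H}_v$ is obtained from $\mathcal{G}$ and $m$ disjoint copies of $\mathcal{H}$ by adding $m$ new edges $e_i=\{v_{i,1},\dots,v_{i,r}\}$ ($i=1,\dots,m$), where $v_{i,1}$ is identified with $u$, $v_{i,r}$ with the vertex $v$ of the $i$-th copy of $\mathcal{H}$, and $v_{i,2},\dots,v_{i,r-1}$ are new distinct vertices; $\mathcal{H}_v\cdot m\mathcal{G}_u$ is defined analogously with $(\mathcal{G},u)$ and $(\mathcal{H},v)$ exchanged. For an $r$-uniform hypergraph $\mathcal{K}$ on $n$ vertices, $m(\mathcal{K},k)$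 is the number of sets of $k$ pairwise disjoint edges ($m(\mathcal{K},0)=1$), $\varphi(\mathcal{K},x)=\sum_{k\geq0}(-1)^km(\mathcal{K},k)x^{n-kr}$, and $ME(\mathcal{K})$ is the sum of absolute values of all roots (with multiplicity) of $\varphi(\mathcal{K},x)$. The adjacency tensor has entries $a_{i_1\cdots i_r}=1/(r-1)!$ if $\{i_1,\dots,i_r\}$ is an edge and $0$ otherwise; $\lambda$ is an eigenvalue if some nonzero $x\in\mathbb{C}^n$ satisfies $\sum_{i_2,\dots,i_r}a_{ii_2\cdots i_r}x_{i_2}\cdots x_{i_r}=\lambda x_i^{r-1}$ for all $i$; $\rho(\mathcal{K})$ is the maximum modulus of the eigenvalues. *)

(* Defs.v *)
From HB Require Import structures.
From mathcomp Require Import all_boot all_order all_algebra.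
From mathcomp Require Import complex.
From mathcomp Require Import reals.
Unset Printing Implicit Defensive.
Import Order.TTheory GRing.Theory Num.Theory.
Local Open Scope ring_scope.

Record hgraph := HGraph { hV : finType ; hE : {set {set hV}} }.

Definition uniform (r : nat) (K : hgraph) : Prop :=
  forall e, e \in hE K -> #|e| = r.

Definition hadj (K : hgraph) : rel (hV K) :=
  fun x y => [exists e in hE K, (x \in e) && (y \in e)].

Definition hconnected (K : hgraph) : Prop :=
  forall x y : hV K, connect (hadj K) x y.

(* Berge cycle of length k+2 >= 2: distinct vertices v_0..v_{k+1} and distinct
   edges e_0..e_{k+1} with v_i, v_{i+1 mod (k+2)} in e_i. *)
Definition has_cycle (K : hgraph) : Prop :=
  exists (k : nat) (vs : 'I_k.+2 -> hV K) (es : 'I_k.+2 -> {set hV K}),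
    [/\ injective vs, injective es &
      forall i : 'I_k.+2,
        [/\ es i \in hE K, vs i \in es i & vs (ordS i) \in es i]].

Definition supertree (r : nat) (K : hgraph) : Prop :=
  [/\ uniform r K, hconnected K & ~ has_cycle K].

Definition hunion (A B : hgraph) : hgraph :=
  @HGraph (hV A + hV B)%type
    ([set (@inl (hV A) (hV B)) @: e | e : {set hV A} in hE A]
     :|: [set (@inr (hV A) (hV B)) @: e | e : {set hV B} in hE B]).

Definition hcopies (k : nat) (G : hgraph) : hgraph :=
  @HGraph ('I_k * hV G)%type
    [set (fun x : hV G => (i, x)) @: e | i : 'I_k, e : {set hV G} in hE G].

(* G_u . m H_v : the new edge e_i = {u, v_{i,2},...,v_{i,r-1}, v^(i)} *)
Definition coal (r : nat) (G : hgraph) (u : hV G) (m : nat) (H : hgraph) (v : hV H)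
  : hgraph :=
  @HGraph (hV G + (('I_m * hV H) + ('I_m * 'I_(r - 2))))%type
    ([set (@inl (hV G) (('I_m * hV H) + ('I_m * 'I_(r - 2)))%type) @: e
        | e : {set hV G} in hE G]
     :|: [set (fun x : hV H => inr (inl (i, x))) @: e | i : 'I_m, e : {set hV H} in hE H]
     :|: [set (inl u |: (inr (inl (i, v)) |: [set inr (inr (i, j)) | j : 'I_(r - 2)]))
         | i : 'I_m]).

Section Spectra.
Variable R : realType.
Local Notation C := R[i].

Definition adj_tensor (r : nat) (K : hgraph) (i : hV K) (t : {ffun 'I_(r.-1) -> hV K})
  : C :=
  if (i |: [set t j | j : 'I_(r.-1)]) \in hE K then ((r.-1)`!)%:R^-1 else 0.

Definition is_eigenvalue (r : nat) (K : hgraph) (lam : C) : Prop :=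
  exists x : hV K -> C, (exists i, x i != 0) /\
    forall i : hV K,
      \sum_(t : {ffun 'I_(r.-1) -> hV K}) adj_tensor r K i t * \prod_(j < r.-1) x (t j)
      = lam * x i ^+ r.-1.

(* spectral radius: the maximum modulus of the eigenvalues (a finite set) *)
Definition rho (r : nat) (K : hgraph) : R :=
  reals.sup (fun y : R => exists2 lam : C, is_eigenvalue r K lam & ComplexField.Normc.normc lam = y).

Definition nmatch (K : hgraph) (k : nat) : nat :=
  #|[set S : {set {set hV K}} | [&& S \subset hE K, #|S| == k &
       [forall e1 in S, forall e2 in S, (e1 != e2) ==> [disjoint e1 & e2]]]]|.

Definition matchpoly (r : nat) (K : hgraph) : {poly C} :=
  \sum_(k < #|hV K|.+1) ((-1) ^+ k * (nmatch K k)%:R) *: 'X^(#|hV K| - k * r)%N.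

Definition ME (r : nat) (K : hgraph) : R :=
  \sum_(z <- sval (closed_field_poly_normal (matchpoly r K))) ComplexField.Normc.normc z.
End Spectra.

(* Main.v *)
From mathcomp Require Import classical_sets topology function_spaces.
From mathcomp Require Import normedtype derive realfun.
Require Import Defs.
From HB Require Import structures.
From mathcomp Require Import all_boot all_order all_algebra.
From mathcomp Require Import complex.
From mathcomp Require Import reals.
From mathcomp Require Import ring lra.

(** For the matching energy, the matching generating polynomial of
   (G_u . m H_v) U (m-1) G is
     g^m h^m + m X g_u h_v g^(m-1) h^(m-1),
   where g, h belong to G, H and g_u, h_v to the edges avoiding u, v: a matching
   contains at most one join edge, since all of them meet in u.  This expression
   is symmetric in (G, u) and (H, v).

   For the spectral radius, if a positive vector z satisfies A z <= lam z^(r-1)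
   then comparing it with an eigenvector shows that no eigenvalue exceeds lam in
   modulus.  So it is enough to exhibit positive eigenvectors of G_u . m H_v and
   H_v . m G_u for the same lam.  Both come from a positive eigenvector (x, y, w)
   of G_u . 1 H_v in which the join edge has weight k = m^(1/r): they are
   (k x, y, w) and (x, k y, w).  Positive eigenvectors exist by minimising lam
   over the positive z with A z <= lam z^(r-1).  Extending by zero, and by x
   on the copies of G, shows that the copies do not change the radius. *)

Set Implicit Arguments.
Unset Strict Implicit.
Unset Printing Implicit Defensive.
Import Order.TTheory GRing.Theory Num.Theory.
Import numFieldNormedType.Exports.
Local Open Scope ring_scope.

(** * Matching polynomials *)

Definition matching (V : finType) (S : {set {set V}}) : bool :=
  [forall e1 in S, forall e2 in S, (e1 != e2) ==> [disjoint e1 & e2]].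

(** Used in place of [matchpoly] because it multiplies over unions without keeping track of vertex
    numbers. Together with the number of vertices it determines [matchpoly], by [coef_match_gf]. *)
Definition match_gf (V : finType) (E : {set {set V}}) : {poly int} :=
  \sum_(S : {set {set V}} | (S \subset E) && matching S) 'X^#|S|.

Lemma matchingP (V : finType) (S : {set {set V}}) :
  reflect {in S &, forall e f : {set V}, e != f -> [disjoint e & f]} (matching S).
Proof.
apply: (iffP forall_inP) => [h e f eS fS ef | h e eS].
  by have /forall_inP/(_ f fS)/implyP := h e eS; apply.
by apply/forall_inP => f fS; apply/implyP; apply: h.
Qed.

Lemma matchingS (V : finType) (S T : {set {set V}}) :
  S \subset T -> matching T -> matching S.
Proof.
move=> /subsetP ST /matchingP h; apply/matchingP => e f eS fS.
by apply: h; apply: ST.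
Qed.

Lemma coef_match_gf (K : hgraph) k :
  (match_gf (hE K))`_k = (nmatch K k)%:R.
Proof.
rewrite /match_gf coef_sum /nmatch -sum1_card natr_sum.
rewrite big_mkcond [RHS]big_mkcond; apply: eq_bigr => S _.
rewrite inE coefXn eq_sym -/(matching S).
by case: (S \subset _); case: (#|S| == k); case: (matching S).
Qed.

(** A matching [S] of the union corresponds to the pair [(S :&: A, S :&: B)]. Conversely any two
    matchings combine, since edges of [A] never meet edges of [B]. *)
Lemma match_gfU (V : finType) (A B : {set {set V}}) :
  [disjoint A & B] -> {in A & B, forall e f : {set V}, [disjoint e & f]} ->
  match_gf (A :|: B) = match_gf A * match_gf B.
Proof.
move=> dAB sepAB.
rewrite /match_gf big_distrlr /= pair_big_dep /=.
rewrite (reindex_onto (fun p : {set {set V}} * {set {set V}} => p.1 :|: p.2)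
  (fun S => (S :&: A, S :&: B))) /=; last first.
  by move=> S /andP[/setIidPl SE _]; rewrite -setIUr SE.
apply: eq_big => [[S T]|[S T]] /=.
  rewrite xpair_eqE; apply/idP/idP.
    move=> /andP[/andP[_ mST] /andP[/eqP SE /eqP TE]].
    have -> : S \subset A by rewrite -SE subsetIr.
    have -> : T \subset B by rewrite -TE subsetIr.
    by rewrite !(matchingS _ mST) ?subsetUl ?subsetUr.
  move=> /andP[/andP[SA mS] /andP[TB mT]].
  have ST : [disjoint S & T].
    by apply: disjointWl SA _; apply: disjointWr TB _.
  rewrite setUSS //=; apply/andP; split.
    apply/matchingP => e f; rewrite !inE => /orP[eS|eT] /orP[fS|fT] ef.
    - by move/matchingP: mS; apply.
    - by apply: sepAB; [apply: (subsetP SA)|apply: (subsetP TB)].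
    - rewrite disjoint_sym.
      by apply: sepAB; [apply: (subsetP SA)|apply: (subsetP TB)].
    - by move/matchingP: mT; apply.
  rewrite !setIUl (setIidPl SA) (setIidPl TB).
  have /eqP -> : T :&: A == set0.
    by rewrite setI_eq0 disjoint_sym; apply: disjointWr TB _.
  have /eqP -> : S :&: B == set0.
    by rewrite setI_eq0; apply: disjointWl SA _.
  by rewrite setU0 set0U !eqxx.
move=> /andP[/andP[SE _] /eqP[SA TB]].
have ST : [disjoint S & T].
  by rewrite -SA -TB; apply: disjointWl (subsetIr _ _) _;
    apply: disjointWr (subsetIr _ _) _.
by rewrite cardsU (eqP (_ : S :&: T == set0)) ?setI_eq0 // cards0 subn0 exprD.
Qed.

Lemma match_gf0 (V : finType) : match_gf (set0 : {set {set V}}) = 1.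
Proof.
rewrite /match_gf (big_pred1 set0) ?cards0 ?expr0 // => S.
rewrite subset0 andb_idr // => /eqP ->.
by apply/matchingP => e f; rewrite inE.
Qed.

(** The empty edge is disjoint from itself and could lie in two families at once. Excluding it makes
    the families disjoint as sets, so that [match_gfU] applies. *)
Lemma match_gf_bigcup (V I : finType) (F : I -> {set {set V}}) :
  (forall i, set0 \notin F i) ->
  (forall i j (e f : {set V}), i != j -> e \in F i -> f \in F j -> [disjoint e & f]) ->
  match_gf (\bigcup_i F i) = \prod_i match_gf (F i).
Proof.
move=> F0 sepF.
have bigcup_seqP s (e : {set V}) : e \in \bigcup_(i <- s) F i ->
    exists2 j, j \in s & e \in F j.
  elim: s => [|i s IHs]; first by rewrite big_nil inE.
  rewrite big_cons inE => /orP[ei|/IHs[j js ej]].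
    by exists i; rewrite ?mem_head.
  by exists j; rewrite // inE js orbT.
rewrite -[LHS]/(match_gf (\bigcup_(i <- index_enum I) F i)).
elim: (index_enum I) (index_enum_uniq I) => [|i s IH] /=.
  by rewrite !big_nil match_gf0.
case/andP=> is_ us; rewrite !big_cons match_gfU ?IH //.
  rewrite disjoints_subset; apply/subsetP => e eF; rewrite inE.
  apply/negP => /bigcup_seqP[j js ej].
  have ij : i != j by apply: contraNneq is_ => ->.
  have := sepF i j e e ij eF ej.
  by rewrite -setI_eq0 setIid => /eqP e0; move: (F0 i); rewrite -e0 eF.
move=> e f eF /bigcup_seqP[j js fj].
have ij : i != j by apply: contraNneq is_ => ->.
exact: sepF ij eF fj.
Qed.

Lemma match_gf_imset (V W : finType) (h : V -> W) (E : {set {set V}}) :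
  injective h -> match_gf [set h @: e | e : {set V} in E] = match_gf E.
Proof.
move=> hI; have hI' : injective (fun e : {set V} => h @: e).
  by apply: imset_inj.
have disj (e f : {set V}) : [disjoint h @: e & h @: f] = [disjoint e & f].
  rewrite -!setI_eq0 -imsetI; last by move=> x y _ _; apply: hI.
  by rewrite imset_eq0.
rewrite /match_gf (reindex_onto (fun S : {set {set V}} => [set h @: e | e : {set V} in S])
   (fun T : {set {set W}} => (fun e : {set V} => h @: e) @^-1: T)) /=; last first.
  move=> T /andP[/subsetP TE _]; apply/setP => f; apply/imsetP/idP.
    by case=> e; rewrite inE => eT ->.
  by move=> fT; have /imsetP[e eE fe] := TE f fT; exists e; rewrite // inE -fe.
apply: eq_big => [S|S _]; last by rewrite card_imset.
have -> : (fun e : {set V} => h @: e) @^-1: [set h @: e | e : {set V} in S] = S.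
  by apply/setP => e; rewrite inE mem_imset.
rewrite eqxx andbT; congr andb.
  apply/subsetP/subsetP => ST e eS.
    by have := ST (h @: e); rewrite !mem_imset //; apply.
  by case/imsetP: eS => f fS ->; rewrite mem_imset ?ST.
apply/matchingP/matchingP => mS.
  move=> e f eS fS ef; rewrite -disj; apply: mS; rewrite ?mem_imset //.
  by rewrite (inj_eq hI').
move=> _ _ /imsetP[e eS ->] /imsetP[f fS ->]; rewrite (inj_eq hI') disj.
exact: mS.
Qed.

(** The edges of [N] pairwise intersect, so a matching contains at most one of them. If it contains
    [n], the rest is a matching among the edges of [E] disjoint from [n]. *)
Lemma match_gf_star (V : finType) (E N : {set {set V}}) :
  [disjoint E & N] -> {in N &, forall e f : {set V}, e != f -> ~~ [disjoint e & f]} ->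
  match_gf (E :|: N) =
  match_gf E + 'X * \sum_(n in N) match_gf [set e in E | [disjoint e & n]].
Proof.
move=> dEN starN; rewrite {1}/match_gf (bigID (fun S : {set {set V}} => [disjoint S & N])) /=.
congr (_ + _).
  apply: eq_bigl => S; apply/idP/idP.
    move=> /andP[/andP[SE ->] SN]; rewrite andbT; apply/subsetP => e eS.
    by have := subsetP SE _ eS; rewrite inE (disjointFr SN eS) orbF.
  move=> /andP[SE ->]; rewrite andbT (subset_trans SE) ?subsetUl //=.
  exact: disjointWl SE _.
rewrite big_distrr /=.
(* A matching that meets [N] does so in exactly one edge [n], so summing over [n] first counts it
   once. *)
transitivity (\sum_(n in N)
    \sum_(S : {set {set V}} | [&& S \subset E :|: N, matching S & n \in S])
      ('X^#|S| : {poly int})).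
  rewrite (exchange_big_dep (fun S : {set {set V}} =>
    (S \subset E :|: N) && matching S && ~~ [disjoint S & N])) /=; last first.
    move=> n S nN /and3P[-> ->] nS /=; rewrite -setI_eq0; apply/set0Pn.
    by exists n; rewrite inE nS.
  apply: eq_bigr => S /andP[/andP[SE mS]].
  rewrite -setI_eq0 => /set0Pn[n /setIP[nS nN]].
  rewrite (big_pred1 n) // => n'; rewrite SE mS /=; apply/andP/eqP => [[n'N n'S]|->//].
  apply: contraTeq isT => nn'.
  by move/negP: (starN _ _ n'N nN nn'); case; move/matchingP: mS; apply.
apply: eq_bigr => n nN; rewrite big_distrr /=.
have nE : n \notin E by rewrite (disjointFl dEN nN).
rewrite (reindex_onto (fun S : {set {set V}} => n |: S) (fun S => S :\ n)) /=; last first.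
  by move=> S /and3P[_ _ nS]; rewrite setD1K.
have key (S : {set {set V}}) : [&& n |: S \subset E :|: N, matching (n |: S) & n \in n |: S]
     && ((n |: S) :\ n == S) =
   (S \subset [set e in E | [disjoint e & n]]) && matching S.
  apply/idP/idP.
    case/andP=> /and3P[SE mS _] /eqP S'.
    have nS : n \notin S by rewrite -S' !inE eqxx.
    rewrite (matchingS (subsetUr _ _) mS) andbT; apply/subsetP => e eS.
    have en : e != n by apply: contraNneq nS => <-.
    have den : [disjoint e & n].
      by move/matchingP: mS; apply; rewrite // !inE ?eS ?eqxx ?orbT.
    rewrite inE den andbT.
    have := subsetP SE e; rewrite !inE eS orbT => /(_ isT) /orP[//|eN].
    by have := starN _ _ eN nN en; rewrite den.
  case/andP => /subsetP SE mS.
  have SEn e : e \in S -> (e \in E) && [disjoint e & n].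
    by move=> /SE; rewrite inE.
  have nS : n \notin S by apply: contra nE => /SEn/andP[].
  rewrite setU11 andbT; apply/andP; split; last first.
    by apply/eqP; rewrite setU1K.
  apply/andP; split.
    apply/subsetP => e; rewrite !inE => /orP[/eqP ->|/SEn/andP[-> //]].
    by rewrite nN orbT.
  apply/matchingP => e f; rewrite !inE => /orP[/eqP->|eS] /orP[/eqP->|fS].
  - by rewrite eqxx.
  - by case/SEn/andP: fS => _; rewrite disjoint_sym.
  - by case/SEn/andP: eS.
  - by move/matchingP: mS; apply.
apply: eq_big => S; first exact: key.
rewrite key => /andP[SE _]; rewrite cardsU1 exprD.
suff -> : n \notin S by [].
by apply: contra nE => /(subsetP SE); rewrite inE => /andP[].
Qed.

(** The family may vary with the copy, because a join edge in a matching restricts one copy of [H]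
    and leaves the others free. *)
Lemma match_gf_copies (V W I : finType) (h : I -> V -> W) (F : I -> {set {set V}}) :
  (forall i j x y, h i x = h j y -> i = j /\ x = y) ->
  (forall i, set0 \notin F i) ->
  match_gf (\bigcup_i [set h i @: e | e : {set V} in F i]) = \prod_i match_gf (F i).
Proof.
move=> hI F0; rewrite match_gf_bigcup.
- apply: eq_bigr => i _; apply: match_gf_imset => x y hxy.
  by have [] := hI _ _ _ _ hxy.
- move=> i; apply/negP => /imsetP[e eF /esym/eqP]; rewrite imset_eq0 => /eqP e0.
  by have := F0 i; rewrite -e0 eF.
move=> i j _ _ ij /imsetP[e _ ->] /imsetP[f _ ->].
rewrite -setI_eq0; apply/eqP/setP => w; rewrite !inE; apply/negP.
case/andP=> /imsetP[x _ ->] /imsetP[y _ xy].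
by have [ij' _] := hI _ _ _ _ xy; rewrite ij' eqxx in ij.
Qed.

Lemma match_gf_sum (V W : finType) (A : {set {set V}}) (B : {set {set W}}) :
  set0 \notin A ->
  match_gf ([set (@inl V W) @: e | e : {set V} in A] :|:
            [set (@inr V W) @: e | e : {set W} in B]) = match_gf A * match_gf B.
Proof.
move=> A0; have sep (e : {set V}) (f : {set W}) : [disjoint @inl V W @: e & @inr V W @: f].
  rewrite -setI_eq0; apply/eqP/setP => w; rewrite !inE; apply/negP.
  by case/andP=> /imsetP[x _ ->] /imsetP[y _ xy].
rewrite match_gfU.
- by rewrite !match_gf_imset //; [move=> x y []|move=> x y []].
- rewrite -setI_eq0; apply/eqP/setP => w; rewrite !inE; apply/negP.
  case/andP=> /imsetP[e eA ->] /imsetP[f _ ef].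
  have := sep e f; rewrite -ef -setI_eq0 setIid imset_eq0 => /eqP e0.
  by rewrite -e0 eA in A0.
by move=> _ _ /imsetP[e _ ->] /imsetP[f _ ->].
Qed.

Lemma imset_copies (I V W : finType) (E : {set {set V}}) (h : I -> V -> W) :
  [set h i @: e | i : I, e : {set V} in E] = \bigcup_i [set h i @: e | e : {set V} in E].
Proof.
apply/setP => f; apply/imset2P/bigcupP => [[i e _ eE ->]|[i _ /imsetP[e eE ->]]].
  by exists i => //; apply/imsetP; exists e.
by exists i e.
Qed.

Lemma match_gf_hcopies k (G : hgraph) :
  set0 \notin hE G -> match_gf (hE (hcopies k G)) = match_gf (hE G) ^+ k.
Proof.
move=> G0 /=; rewrite (imset_copies _ pair) match_gf_copies //.
  by rewrite prodr_const card_ord.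
by move=> i j x y [-> ->].
Qed.

Definition avoiding (V : finType) (E : {set {set V}}) (u : V) :=
  [set e in E | u \notin e].

(** * Matchings of a coalescence *)

Section Coalescence.
Variables (r m : nat) (G H : hgraph) (u : hV G) (v : hV H).
Local Notation K := (coal r G u m H v).

Definition coal_l (x : hV G) : hV K := inl x.
Definition coal_r (i : 'I_m) (x : hV H) : hV K := inr (inl (i, x)).
Definition coal_mid (i : 'I_m) (j : 'I_(r - 2)) : hV K := inr (inr (i, j)).
Definition join_edge (i : 'I_m) : {set hV K} :=
  coal_l u |: (coal_r i v |: [set coal_mid i j | j : 'I_(r - 2)]).

Lemma coal_l_inj : injective coal_l. Proof. by move=> x y []. Qed.
Lemma coal_r_inj i j x y : coal_r i x = coal_r j y -> i = j /\ x = y.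
Proof. by case=> -> ->. Qed.

Lemma coal_edges : hE K =
  ([set coal_l @: e | e : {set hV G} in hE G] :|:
   \bigcup_i [set coal_r i @: e | e : {set hV H} in hE H]) :|:
  [set join_edge i | i : 'I_m].
Proof. by rewrite -imset_copies. Qed.

Lemma join_edge_l i x : (coal_l x \in join_edge i) = (x == u).
Proof.
have midF : (coal_l x \in [set coal_mid i j | j : 'I_(r - 2)]) = false.
  by apply/negP => /imsetP[].
by rewrite in_setU1 in_setU1 midF (inj_eq coal_l_inj) !orbF.
Qed.

Lemma join_edge_r i j x : (coal_r j x \in join_edge i) = (j == i) && (x == v).
Proof.
have midF : (coal_r j x \in [set coal_mid i j | j : 'I_(r - 2)]) = false.
  by apply/negP => /imsetP[].
by rewrite in_setU1 in_setU1 midF orbF.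
Qed.

Lemma join_edge_mid i j k : (coal_mid j k \in join_edge i) = (j == i).
Proof.
rewrite in_setU1 in_setU1 /=.
by apply/imsetP/eqP => [[k' _ []]//|->]; exists k.
Qed.

Lemma join_edge_inj : injective join_edge.
Proof.
move=> i j ij; have := join_edge_r i i v.
by rewrite ij join_edge_r !eqxx andbT => /eqP.
Qed.

Lemma disjoint_l_r i (e : {set hV G}) (f : {set hV H}) :
  [disjoint coal_l @: e & coal_r i @: f].
Proof.
rewrite -setI_eq0; apply/eqP/setP => w; rewrite !inE; apply/negP.
by case/andP=> /imsetP[x _ ->] /imsetP[].
Qed.

Lemma disjoint_l_join i (e : {set hV G}) :
  [disjoint coal_l @: e & join_edge i] = (u \notin e).
Proof.
apply/idP/idP; last first.
  move=> ue; rewrite -setI_eq0; apply/eqP/setP => w; rewrite inE in_set0; apply/negP.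
  case/andP=> /imsetP[x xe ->]; rewrite join_edge_l => /eqP xu.
  by rewrite -xu xe in ue.
by apply: contraTN => ue; rewrite -setI_eq0; apply/set0Pn; exists (coal_l u);
  rewrite inE join_edge_l eqxx imset_f.
Qed.

Lemma disjoint_r_join i j (e : {set hV H}) :
  [disjoint coal_r j @: e & join_edge i] = (j != i) || (v \notin e).
Proof.
rewrite -negb_and; apply/idP/idP; last first.
  move=> ue; rewrite -setI_eq0; apply/eqP/setP => w; rewrite inE in_set0; apply/negP.
  case/andP=> /imsetP[x xe ->]; rewrite join_edge_r => /andP[/eqP ij /eqP xv].
  by rewrite -xv xe ij eqxx in ue.
apply: contraTN => /andP[/eqP -> ve]; rewrite -setI_eq0; apply/set0Pn; exists (coal_r i v).
by rewrite inE join_edge_r !eqxx imset_f.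
Qed.

Lemma disjoint_edges_l_r (P : {set {set hV G}}) (F : 'I_m -> {set {set hV H}}) :
  set0 \notin P ->
  [disjoint [set coal_l @: e | e : {set hV G} in P] &
            \bigcup_i [set coal_r i @: e | e : {set hV H} in F i]].
Proof.
move=> P0; rewrite -setI_eq0; apply/eqP/setP => w; rewrite !inE; apply/negP.
case/andP=> /imsetP[e eP ->] /bigcupP[i _ /imsetP[f _ ef]].
have := disjoint_l_r i e f; rewrite -ef -setI_eq0 setIid imset_eq0 => /eqP e0.
by rewrite -e0 eP in P0.
Qed.

Lemma disjoint_edges_join (P : {set {set hV G}}) (F : 'I_m -> {set {set hV H}}) :
  [disjoint [set coal_l @: e | e : {set hV G} in P] :|:
            \bigcup_i [set coal_r i @: e | e : {set hV H} in F i] &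
            [set join_edge i | i : 'I_m]].
Proof.
rewrite -setI_eq0; apply/eqP/setP => w; rewrite in_setI in_setU in_set0; apply/negP.
case/andP=> /orP[/imsetP[e _ ->]|/bigcupP[i _ /imsetP[e _ ->]]] /imsetP[k _ ek].
  by have := join_edge_r k k v; rewrite -ek !eqxx /= => /imsetP[].
by have := join_edge_l k u; rewrite -ek eqxx => /imsetP[].
Qed.

(** The first term counts the matchings without join edge. A matching through join edge [i] must
    avoid [u] in [G] and [v] in copy [i], and is unrestricted in the other [m.-1] copies. All join
    edges contain [u], so [match_gf_star] applies. *)
Lemma match_gf_coal :
  set0 \notin hE G -> set0 \notin hE H ->
  match_gf (hE K) =
  match_gf (hE G) * match_gf (hE H) ^+ m +
  'X * (match_gf (avoiding (hE G) u) * match_gf (avoiding (hE H) v) *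
         match_gf (hE H) ^+ m.-1) *+ m.
Proof.
move=> G0 H0.
have split_gf (P : {set {set hV G}}) (F : 'I_m -> {set {set hV H}}) :
    set0 \notin P -> (forall i, set0 \notin F i) ->
    match_gf ([set coal_l @: e | e : {set hV G} in P] :|:
       \bigcup_i [set coal_r i @: e | e : {set hV H} in F i]) =
    match_gf P * \prod_i match_gf (F i).
  move=> P0 F0; rewrite match_gfU ?disjoint_edges_l_r //.
    rewrite match_gf_imset; last exact: coal_l_inj.
    by rewrite match_gf_copies //; exact: coal_r_inj.
  move=> _ _ /imsetP[e _ ->] /bigcupP[i _ /imsetP[f _ ->]].
  exact: disjoint_l_r.
rewrite coal_edges match_gf_star ?disjoint_edges_join //; last first.
  move=> _ _ /imsetP[i _ ->] /imsetP[j _ ->] _; rewrite -setI_eq0.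
  by apply/set0Pn; exists (coal_l u); rewrite in_setI !join_edge_l eqxx.
rewrite split_gf // prodr_const card_ord; congr (_ + _); rewrite -mulrnAr; congr (_ * _).
rewrite big_imset /=; last by move=> i j _ _; apply: join_edge_inj.
rewrite (eq_bigr (fun=> match_gf (avoiding (hE G) u) * match_gf (avoiding (hE H) v) *
         match_gf (hE H) ^+ m.-1)) ?sumr_const ?card_ord // => i _.
pose F j := if j == i then avoiding (hE H) v else hE H.
have F0 j : set0 \notin F j.
  by rewrite /F; case: ifP => // _; rewrite inE negb_and H0.
rewrite (_ : [set e in _ | _] =
   [set coal_l @: e | e : {set hV G} in avoiding (hE G) u] :|:
       \bigcup_i [set coal_r i @: e | e : {set hV H} in F i]).
  rewrite split_gf //; last by rewrite inE negb_and G0.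
  rewrite -mulrA (bigD1 i) //= /F eqxx; congr (_ * (_ * _)).
  rewrite (eq_bigr (fun=> match_gf (hE H))); last by move=> j /negbTE ->.
  by rewrite prodr_const cardC1 card_ord.
apply/setP => f; rewrite !inE; apply/andP/orP.
  case=> /orP[/imsetP[e eG ->]|/bigcupP[j _ /imsetP[e eH ->]]].
    by rewrite disjoint_l_join => ue; left; apply: imset_f; rewrite inE eG.
  rewrite disjoint_r_join => ve; right; apply/bigcupP; exists j => //; apply: imset_f.
  by rewrite /F; case: eqP ve => //= _ ve; rewrite inE eH.
case=> [/imsetP[e]|/bigcupP[j _ /imsetP[e]]].
  rewrite inE => /andP[eG ue] ->; rewrite disjoint_l_join ue; split=> //.
  by rewrite imset_f.
move=> eF ->; rewrite disjoint_r_join; move: eF; rewrite /F; case: eqP => [_|_] /=.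
  rewrite inE => /andP[eH ve]; split=> //; apply/orP; right.
  by apply/bigcupP; exists j => //; apply: imset_f.
move=> eH; split=> //; apply/orP; right.
by apply/bigcupP; exists j => //; apply: imset_f.
Qed.


End Coalescence.

Lemma match_gf_swap r (G H : hgraph) (u : hV G) (v : hV H) m :
  (0 < m)%N -> set0 \notin hE G -> set0 \notin hE H ->
  match_gf (hE (hunion (coal r G u m H v) (hcopies m.-1 G))) =
  match_gf (hE (hunion (coal r H v m G u) (hcopies m.-1 H))).
Proof.
have coal0 (A B : hgraph) (a : hV A) (b : hV B) : set0 \notin hE A -> set0 \notin hE B ->
   set0 \notin hE (coal r A a m B b).
  move=> A0 B0; apply/negP; rewrite !inE.
  case/orP=> [/orP[/imsetP[e eA]|/imset2P[i e _ eB]]|/imsetP[i _]].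
  - by move/esym/eqP; rewrite imset_eq0 => /eqP e0; rewrite -e0 eA in A0.
  - by move/esym/eqP; rewrite imset_eq0 => /eqP e0; rewrite -e0 eB in B0.
  by move/setP/(_ (inl a)); rewrite !inE eqxx.
case: m coal0 => // m coal0 _ G0 H0.
rewrite !match_gf_sum ?coal0 // !match_gf_hcopies // !match_gf_coal //= !exprS.
rewrite !mulrDl !mulrnAl; move: (match_gf (hE G)) (match_gf (hE H)) => g h.
move: (match_gf _) (match_gf _) (g ^+ m) (h ^+ m) 'X => gu hv gm hm x.
by congr (_ + _ *+ _); ring.
Qed.

Lemma matchpoly_swap (R : realType) r (G H : hgraph) (u : hV G) (v : hV H) m :
  (0 < m)%N -> set0 \notin hE G -> set0 \notin hE H ->
  matchpoly R r (hunion (coal r G u m H v) (hcopies m.-1 G)) =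
  matchpoly R r (hunion (coal r H v m G u) (hcopies m.-1 H)).
Proof.
move=> m0 G0 H0; rewrite /matchpoly.
(* Both hypergraphs have [m * #|hV G| + m * #|hV H| + m * (r - 2)] vertices. *)
have -> : #|hV (hunion (coal r G u m H v) (hcopies m.-1 G))| =
          #|hV (hunion (coal r H v m G u) (hcopies m.-1 H))|.
  rewrite /= !(card_sum, card_prod, card_ord).
  by case: m m0 => // m _ /=; ring.
apply: eq_bigr => k _; congr ((_ * _) *: _).
have := congr1 (fun p : {poly int} => p`_k) (match_gf_swap r u v m0 G0 H0).
by rewrite !coef_match_gf => /eqP; rewrite eqr_nat => /eqP ->.
Qed.

(** * Positive eigenvectors *)

(** The action of the adjacency tensor, with edge weights [c]; weight 1 is the tensor itself, by
    [adj_tensor_sum]. The weights serve the join edge of weight k, and the general ring allows both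
    real and complex vectors. *)
Definition edge_sum (A : comPzRingType) (V : finType) (E : {set {set V}})
    (c : {set V} -> A) (x : V -> A) (i : V) : A :=
  \sum_(e in E | i \in e) c e * \prod_(j in e :\ i) x j.

(** Lets [perron] lower a coordinate at a strict vertex without losing strictness there. Each
    induction step spends half of the gap between [a] and [b] on one factor [s]. *)
Lemma pow_shrink (R : realFieldType) (a b : R) n :
  0 <= a < b -> exists2 s, 0 < s < 1 & a < b * s ^+ n.
Proof.
elim: n b => [|n IH] b ab.
  by exists 2^-1; [lra | rewrite mulr1; lra].
have [|s s01 as_] := IH ((a + b) / 2); first lra.
have mid : (a + b) / 2 < b by lra.
have b0 : 0 < b by lra.
(* The second argument makes [b] times the maximum at least the midpoint; the first keeps the bound
   on the remaining [n] factors. *)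
exists (Num.max s ((a + b) / 2 / b)).
  rewrite lt_max gt_max ltr_pdivrMr // mul1r mid; lra.
apply: (lt_le_trans as_); rewrite exprS mulrA ler_pM //.
- lra.
- by apply: exprn_ge0; lra.
- by rewrite [b * _]mulrC -ler_pdivrMr // le_max lexx orbT.
by apply: lerXn2r; rewrite ?nnegrE ?le_max ?lexx //; lra.
Qed.

Section Perron.
Variables (R : realType) (V : finType) (E : {set {set V}}) (c : {set V} -> R) (n : nat).
Hypothesis c_ge1 : forall e, e \in E -> 1 <= c e.
Hypothesis E_unif : forall e, e \in E -> #|e| = n.+1.
Local Notation adj := (fun x y : V => [exists e in E, (x \in e) && (y \in e)]).
Hypothesis E_conn : forall x y, connect adj x y.

Let c_ge0 e : e \in E -> 0 <= c e.
Proof. by move=> /c_ge1; apply: le_trans. Qed.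

Lemma ler_edge_sum (x y : V -> R) i :
  (forall j, 0 <= x j <= y j) -> edge_sum E c x i <= edge_sum E c y i.
Proof.
move=> xy; apply: ler_sum => e /andP[eE _]; apply: ler_wpM2l; first exact: c_ge0.
by apply: ler_prod => j _.
Qed.

Lemma edge_sum_ge0 (x : V -> R) i : (forall j, 0 <= x j) -> 0 <= edge_sum E c x i.
Proof.
move=> x0; apply: sumr_ge0 => e /andP[eE _]; apply: mulr_ge0; first exact: c_ge0.
exact: prodr_ge0.
Qed.

Lemma edge_sumZ (x : V -> R) t i :
  edge_sum E c (fun j => t * x j) i = t ^+ n * edge_sum E c x i.
Proof.
rewrite /edge_sum mulr_sumr; apply: eq_bigr => e /andP[eE ie].
rewrite big_split /= prodr_const mulrCA.
by have := E_unif eE; rewrite (cardsD1 i) ie add1n => -[->].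
Qed.

(* At a vertex j of e where y is least, y k * y j ^+ n.-1 <= L * y j ^+ n. *)
Lemma harnack_edge (L : R) (y : V -> R) e i k : 1 <= L -> (forall j, 0 < y j) ->
  (forall j, edge_sum E c y j <= L * y j ^+ n) ->
  e \in E -> i \in e -> k \in e -> y k <= L * y i.
Proof.
move=> L1 y0 yL eE ie ke.
case: (@Order.TotalTheory.arg_minP _ R V i (mem e) y ie) => j je0 jmin; have je : j \in e := je0.
suff kj : y k <= L * y j.
  by apply: le_trans kj _; apply: ler_wpM2l; [apply: le_trans L1|apply: jmin].
have [->|kj] := eqVneq k j.
  by rewrite -[X in X <= _]mul1r ler_wpM2r // ltW.
have kej : k \in e :\ j by rewrite !inE kj.
have le1 : \prod_(l in e :\ j) y l <= L * y j ^+ n.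
  apply: le_trans (yL j); rewrite /edge_sum (bigD1 e) ?eE //=.
  rewrite -[X in X <= _]addr0 lerD //; last first.
    apply: sumr_ge0 => f /andP[/andP[fE _] _]; apply: mulr_ge0; first exact: c_ge0.
    by apply: prodr_ge0 => l _; apply: ltW.
  rewrite -[X in X <= _]mul1r ler_wpM2r ?c_ge1 //.
  by apply: prodr_ge0 => l _; apply: ltW.
have card_ej : #|(e :\ j) :\ k|.+1 = n.
  have := E_unif eE; rewrite (cardsD1 j) je add1n => -[<-].
  by rewrite [RHS](cardsD1 k) kej.
have le2 : y k * y j ^+ n.-1 <= \prod_(l in e :\ j) y l.
  rewrite (big_setD1 k) //= ler_pM2l // -card_ej /= -prodr_const.
  apply: ler_prod => l; rewrite !inE => /and3P[_ _ le].
  by rewrite ltW //=; apply: jmin.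
have := le_trans le2 le1; rewrite -[in X in _ <= X]card_ej -[in X in X <= _]card_ej /=.
by rewrite exprS mulrA ler_pM2r // exprn_gt0.
Qed.

(** Each edge of a path costs a factor [L], by [harnack_edge]. A path without repeated vertices has
    at most [#|V|] edges. *)
Lemma harnack (L : R) (y : V -> R) i k : 1 <= L -> (forall j, 0 < y j) ->
  (forall j, edge_sum E c y j <= L * y j ^+ n) ->
  y k <= L ^+ #|V| * y i.
Proof.
move=> L1 y0 yL.
have [p pth ->] := connectP (E_conn k i).
case/shortenP: pth => q pth uq _.
have : (size q <= #|V|)%N.
  by rewrite (leq_trans _ (max_card (mem (k :: q)))) // (card_uniqP uq) /=.
move=> sq; apply: le_trans (_ : L ^+ size q * y (last k q) <= _); last first.
  by rewrite ler_wpM2r ?ler_weXn2l // ltW.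
elim: q k pth {uq sq} => [|l q IH] k /=; first by rewrite expr0 mul1r.
case/andP=> /exists_inP[e eE /andP[ke le]] pq.
rewrite exprS -mulrA; apply: le_trans (harnack_edge L1 y0 yL eE le ke) _.
by apply: ler_wpM2l; [apply: le_trans L1|apply: IH].
Qed.

(** Makes the constraints in [perron_inf] closed conditions. *)
Lemma continuous_defect (T : topologicalType) (lam : T -> R) (x : V -> T -> R) i :
  continuous lam -> (forall j, continuous (x j)) ->
  continuous (fun t => lam t * x i t ^+ n - edge_sum E c (fun j => x j t) i).
Proof.
move=> lam_cont x_cont t; apply: (@cvgB _ _ _ (nbhs t)).
  apply: cvgM; first exact: lam_cont.
  by apply: (@continuous_comp _ _ _ (x i) (fun z : R => z ^+ n));
    [exact: x_cont|exact: exprn_continuous].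
apply: (@cvg_big _ _ _ _ _ (@add_continuous _)) => e _.
apply: cvgM; first exact: cvg_cst.
by apply: (@cvg_big _ _ _ _ _ (@mul_continuous _)) => j _; exact: x_cont.
Qed.

(* By [harnack], a vector normalised to have maximum 1 lies in a compact box
   bounded away from 0, so the infimum of lam is attained. *)
Lemma perron_inf (i0 : V) : exists lam x, [/\ 0 <= lam, forall i, 0 < x i,
  forall i, edge_sum E c x i <= lam * x i ^+ n &
  forall mu y, (forall i, 0 < y i) -> (forall i, edge_sum E c y i <= mu * y i ^+ n) ->
    lam <= mu].
Proof.
(* The sum of all weights bounds the edge sums of the constant vector 1, so that vector is feasible
   with [lam = L]. The added 1 gives [1 <= L], which [harnack] needs. *)
pose L := 1 + \sum_(e in E) c e.
have L1 : 1 <= L by rewrite lerDl sumr_ge0.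
have L0 : 0 < L by apply: lt_le_trans L1.
pose d := (L ^+ #|V|)^-1.
have d0 : 0 < d by rewrite invr_gt0 exprn_gt0.
have d1 : d <= 1 by rewrite invf_le1 ?exprn_gt0 // exprn_ege1.
(* The index [None] carries lam, so that minimising lam is minimising a coordinate. *)
pose box (o : option V) : set R := if o is Some _ then `[d, 1]%classic else `[0, L]%classic.
pose A : set (prod_topology (fun _ : option V => R)) := fun f => forall o, box o (f o).
pose g i (f : prod_topology (fun _ : option V => R)) : R :=
  f None * f (Some i) ^+ n - edge_sum E c (fun j => f (Some j)) i.
pose D : set (prod_topology (fun _ : option V => R)) :=
  (A `&` \bigcap_i [set f | (0 <= g i f)%R])%classic.
have cont o : continuous (fun f : prod_topology (fun _ : option V => R) => f o : R).
  exact: (@proj_continuous (option V) (fun=> R) o).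
have contg i : continuous (g i).
  exact: continuous_defect.
have cA : compact A.
  by apply: tychonoff => -[i|]; exact: segment_compact.
have cD : compact D.
  apply: compact_closedI => //; apply: closed_bigI => i _.
  by apply: (@preimage_closed _ _ (g i) [set z : R | 0 <= z]%classic);
    [by move=> f _; exact: contg|exact: closed_ge].
have D0 : (D !=set0)%classic.
  exists (fun o => if o is Some _ then 1 else L); split.
    by move=> [i|] /=; rewrite in_itv /= ?lexx ?d1 // ltW.
  move=> i _ /=; rewrite /g expr1n mulr1 subr_ge0 /edge_sum /L.
  rewrite -[X in X <= _]add0r lerD // [leRHS](bigID (fun e : {set V} => i \in e)) /=.
  rewrite -[X in X <= _]addr0 lerD //.
    by apply: ler_sum => e _; rewrite big1 ?mulr1.
  by apply: sumr_ge0 => e /andP[eE _]; apply: c_ge0.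
have [f /set_mem[Af gf] fmin] :=
  compact_EVT_min D0 cD (continuous_subspaceT (cont None)).
have box_bnd i : d <= f (Some i) <= 1 by have := Af (Some i); rewrite /= in_itv.
have f0 i : 0 < f (Some i) by have /andP[+ _] := box_bnd i; apply: lt_le_trans.
have /andP[lam0 lamL] : 0 <= f None <= L by have := Af None; rewrite /= in_itv.
exists (f None), (fun i => f (Some i)); split => //.
  by move=> i; rewrite -subr_ge0; apply: gf.
(* Values [mu >= L] are harmless because the minimiser has [f None <= L]. For [mu < L], dividing [y]
   by its maximum brings it into the box. *)
move=> mu y y0 ymu; have [Lmu|muL] := lerP L mu; first exact: le_trans lamL Lmu.
have mu0 : 0 <= mu.
  rewrite -(pmulr_lge0 _ (exprn_gt0 n (y0 i0))); apply: le_trans (ymu i0).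
  by apply: edge_sum_ge0 => j; apply: ltW.
case: (@Order.TotalTheory.arg_maxP _ R V i0 xpredT y isT) => k _ kmax.
pose z i := (y k)^-1 * y i.
have z0 i : 0 < z i by rewrite mulr_gt0 ?invr_gt0.
have zmu i : edge_sum E c z i <= mu * z i ^+ n.
  by rewrite edge_sumZ exprMn mulrCA ler_wpM2l // exprn_ge0 // invr_ge0 ltW.
pose h (o : option V) := if o is Some i then z i else mu.
suff /mem_set/fmin : D h by [].
split.
  move=> [i|] /=; rewrite in_itv /= ?mu0 ?(ltW muL) //.
  have zk : z k = 1 by rewrite /z mulVf // gt_eqF.
  apply/andP; split; last by rewrite /z mulrC ler_pdivrMr // mul1r; exact: kmax.
  (* The lower bound [d] comes from comparing with [z k = 1] by [harnack], used with [L] instead of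
     the smaller [mu]. *)
  rewrite /d -[leLHS]mulr1 mulrC ler_pdivrMr ?exprn_gt0 // mulrC -[leLHS]zk.
  apply: harnack => // j; apply: le_trans (zmu j) _.
  by apply: ler_wpM2r; rewrite ?exprn_ge0 ?ltW.
by move=> i _ /=; rewrite /g subr_ge0; apply: zmu.
Qed.

(** Take the least [lam] admitting a positive [x] with edge sums at most [lam * x i ^+ n]. If some
    but not all of these inequalities are strict, connectedness allows one more to be made strict;
    if all are, [lam] is not least. As the number of strict ones cannot grow forever, some such [x]
    has only equalities. *)
Lemma perron (i0 : V) : exists lam x, [/\ 0 <= lam, forall i, 0 < x i &
  forall i, edge_sum E c x i = lam * x i ^+ n].
Proof.
have [lam [x0 [lam0 x0_gt0 x0_le lam_min]]] := perron_inf i0.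
pose S (x : {ffun V -> R}) := [set i | edge_sum E c x i < lam * x i ^+ n].
pose good (x : {ffun V -> R}) :=
  (forall i, 0 < x i) /\ (forall i, edge_sum E c x i <= lam * x i ^+ n).
suff [x [x_gt0 x_le] Sx] : exists2 x, good x & S x = set0.
  exists lam, x; split=> // i; apply/eqP; rewrite eq_le x_le /= leNgt.
  by have := in_set0 i; rewrite -Sx inE => ->.
(* Lowering x at a strict vertex a with a non-strict neighbour b keeps a strict
   and makes b strict. *)
have improve x : good x -> S x != set0 -> exists2 y, good y & (#|S x| < #|S y|)%N.
  move=> [x_gt0 x_le] /set0Pn[i iS].
  (* If every vertex were strict, the largest ratio [q k] would be an admissible value below
     [lam]. *)
  have [j jS] : exists j, j \notin S x.
    apply/existsP; rewrite -negb_forall; apply/negP => /forallP allS.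
    pose q i := edge_sum E c x i / x i ^+ n.
    case: (@Order.TotalTheory.arg_maxP _ R V i0 xpredT q isT) => k _ kmax.
    have : lam <= q k.
      apply: (lam_min _ x) => // l; rewrite -ler_pdivrMr ?exprn_gt0 //.
      exact: kmax.
    rewrite leNgt ltr_pdivrMr ?exprn_gt0 //.
    by have := allS k; rewrite inE => ->.
  (* A path from [i] to [j] leaves [S x] through some edge. *)
  have [a [b [e [aS bS eE ae be]]]] : exists a b e,
      [/\ a \in S x, b \notin S x, e \in E, a \in e & b \in e].
    have [p pth jE] := connectP (E_conn i j); rewrite {}jE in jS.
    elim: p i iS pth jS => [|l p IH] i iS /=; first by rewrite iS.
    case/andP=> /exists_inP[e eE /andP[ie le]] pth lastS.
    have [lS|lS] := boolP (l \in S x); first exact: IH lS pth lastS.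
    by exists i, l, e.
  have [s /andP[s0 s1] as_] : exists2 s, 0 < s < 1 &
      edge_sum E c x a < lam * x a ^+ n * s ^+ n.
    apply: pow_shrink; rewrite edge_sum_ge0 => [|k]; last exact: ltW.
    by move: aS; rewrite inE.
  pose y := [ffun k => if k == a then s * x a else x k].
  have y_neq k : k != a -> y k = x k by rewrite ffunE => /negbTE ->.
  have y_gt0 k : 0 < y k by rewrite ffunE; case: eqP => // _; apply: mulr_gt0.
  have yx k : 0 <= y k <= x k.
    rewrite ltW //= ffunE; case: eqP => // ->.
    by rewrite ger_pMl // ltW.
  have sum_le k := ler_edge_sum k yx.
  have ltya : edge_sum E c y a < lam * y a ^+ n.
    by rewrite ffunE eqxx exprMn mulrCA mulrC; apply: le_lt_trans (sum_le a) _.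
  have gy : good y.
    split=> // k; have [->|ka] := eqVneq k a; first exact: ltW.
    by rewrite y_neq //; apply: le_trans (sum_le k) _.
  exists y => //; apply/proper_card/properP; split.
    apply/subsetP => k; rewrite !inE => kS; have [->//|ka] := eqVneq k a.
    by rewrite y_neq //; apply: le_lt_trans (sum_le k) _.
  have ba : b != a by apply: contraNneq bS => ->.
  exists b => //; rewrite inE y_neq //; apply: lt_le_trans (x_le b).
  rewrite /edge_sum (bigD1 e) ?eE //= [ltRHS](bigD1 e) ?eE //=.
  apply: ltr_leD; last first.
    apply: ler_sum => f /andP[/andP[fE _] _]; apply: ler_wpM2l; first exact: c_ge0.
    by apply: ler_prod => k _.
  rewrite ltr_pM2l; last by apply: lt_le_trans (c_ge1 eE).
  have aeb : a \in e :\ b by rewrite !inE ae eq_sym ba.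
  rewrite (big_setD1 a) //= [ltRHS](big_setD1 a) //=.
  rewrite (eq_bigr x) => [|k]; last first.
    by rewrite !inE => /andP[ka _]; apply: y_neq.
  rewrite ltr_pM2r; last by apply: prodr_gt0.
  by rewrite ffunE eqxx gtr_pMl.
have start : good [ffun i => x0 i].
  split=> i; first by rewrite ffunE.
  by rewrite ffunE (_ : edge_sum _ _ _ _ = edge_sum E c x0 i) //;
    apply: eq_bigr => e _; congr (_ * _); apply: eq_bigr => j _; rewrite ffunE.
(* Induction on a bound for the number of non-strict vertices, which [improve] decreases. *)
have: (#|V| - #|S [ffun i => x0 i]| < #|V|.+1)%N by rewrite ltnS leq_subr.
move: [ffun i => x0 i] start (#|V|.+1) => x gx k.
elim: k x gx => // k IH x gx xk.
have [Sx|Sx] := eqVneq (S x) set0; first by exists x.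
have [y gy xy] := improve x gx Sx.
apply: (IH y gy); rewrite ltnS in xk; apply: leq_trans xk.
by rewrite ltn_sub2l // (leq_trans xy) // max_card.
Qed.
End Perron.

(** * Spectral radius *)

(** The set [e :\ i] has exactly [n] elements, so a tuple of length [n] covering it can neither
    repeat a value nor take the value [i]. *)
Lemma inj_onto_edge (V : finType) n (e : {set V}) (i : V) (t : {ffun 'I_n -> V}) :
  #|e| = n.+1 -> i \in e ->
  (i |: [set t j | j : 'I_n] == e) =
  (t \in [set f : {ffun 'I_n -> V} in ffun_on (mem (e :\ i)) | injectiveb f]).
Proof.
move=> ce ie; have ce' : #|e :\ i| = n by have := cardsD1 i e; rewrite ce ie => -[].
rewrite inE; apply/idP/andP.
  move=> /eqP te.
  have im_t : e :\ i == [set t j | j : 'I_n].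
    rewrite eqEcard ce' (leq_trans (leq_imset_card _ _)) ?card_ord // andbT.
    by rewrite -te; apply/subsetP => k; rewrite !inE => /andP[/negbTE ->].
  split.
    by apply/ffun_onP => j; change (t j \in e :\ i); rewrite (eqP im_t) imset_f.
  have /imset_injP t_inj : #|[set t j | j : 'I_n]| == #|'I_n|.
    by rewrite -(eqP im_t) ce' card_ord.
  by apply/injectiveP => j k; apply: t_inj.
case=> /ffun_onP t_e /injectiveP t_inj.
suff /eqP -> : [set t j | j : 'I_n] == e :\ i by rewrite setD1K.
rewrite eqEcard (card_imset _ t_inj) card_ord ce' leqnn andbT.
by apply/subsetP => _ /imsetP[j _ ->]; apply: t_e.
Qed.

(** Group the tuples by the edge they form with [i]. Each edge through [i] arises from [(r.-1)!]
    injective tuples with the same product, which cancels the tensor entry. *)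
Lemma adj_tensor_sum (R : realType) r (K : hgraph) (x : hV K -> R[i]) i :
  (0 < r)%N -> uniform r K ->
  \sum_(t : {ffun 'I_(r.-1) -> hV K}) adj_tensor R r K i t * \prod_(j < r.-1) x (t j)
  = edge_sum (hE K) (fun=> 1) x i.
Proof.
case: r => // n _ K_unif /=.
rewrite (eq_bigr (fun t : {ffun 'I_n -> hV K} => if (i |: [set t j | j : 'I_n]) \in hE K then
   (n`!)%:R^-1 * \prod_(j < n) x (t j) else 0)); last first.
  by move=> t _; rewrite /adj_tensor /=; case: ifP; rewrite ?mul0r.
rewrite -big_mkcond /= (partition_big (fun t : {ffun 'I_n -> hV K} => i |: [set t j | j : 'I_n])
  (fun e => (e \in hE K) && (i \in e))) /=; last by move=> t ->; rewrite setU11.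
apply: eq_bigr => e /andP[eE ie]; have ce := K_unif e eE.
rewrite (eq_bigl (fun t => t \in [set f : {ffun 'I_n -> hV K} in
    ffun_on (mem (e :\ i)) | injectiveb f]));
  last first.
  move=> t; rewrite -inj_onto_edge //; apply: andb_idl => /eqP ->; exact: eE.
rewrite (eq_bigr (fun=> (n`!)%:R^-1 * \prod_(k in e :\ i) x k)); last first.
  move=> t te; have := te; rewrite -inj_onto_edge // => /eqP it.
  move: te; rewrite inE => /andP[/ffun_onP t_e /injectiveP t_inj].
  have -> : e :\ i = [set t j | j : 'I_n].
    rewrite -it setU1K //; apply/imsetP => -[j _ ij].
    by have := t_e j; rewrite -ij => /setD1P[]; rewrite eqxx.
  by rewrite big_imset //= => j k _ _; apply: t_inj.
rewrite sumr_const card_inj_ffuns_on card_ord.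
have -> : #|mem (e :\ i)| = n.
  by have := cardsD1 i e; rewrite ce ie => -[].
rewrite ffactnn -mulrnAl -[_ *+ _]mulr_natr mulVf ?mul1r //.
by rewrite pnatr_eq0 -lt0n fact_gt0.
Qed.

Lemma eigenvalue_real (R : realType) r (K : hgraph) (x : hV K -> R) lam i0 :
  (0 < r)%N -> uniform r K -> x i0 != 0 ->
  (forall i, edge_sum (hE K) (fun=> 1) x i = lam * x i ^+ r.-1) ->
  is_eigenvalue R r K (lam%:C)%C.
Proof.
move=> r0 K_unif xi0 eig; exists (fun i => ((x i)%:C)%C); split.
  by exists i0; rewrite (fmorph_eq0 (real_complex R)).
move=> i; rewrite (adj_tensor_sum (fun j => ((x j)%:C)%C)) // -rmorphXn -rmorphM.
rewrite -eig /edge_sum rmorph_sum.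
by apply: eq_bigr => e _; rewrite !mul1r rmorph_prod.
Qed.

(** By the triangle inequality the moduli [a] of an eigenvector satisfy [|mu| a^(r-1) <= A a]. At a
    vertex [k] maximising [a / z], with ratio [q], this gives [|mu| a_k^(r-1) <= q^(r-1) (A z)_k <=
    lam (q z_k)^(r-1) = lam a_k^(r-1)], and [a_k > 0]. *)
Lemma eigenvalue_le (R : realType) r (K : hgraph) (z : hV K -> R) lam mu :
  (0 < r)%N -> uniform r K -> (forall i, 0 < z i) ->
  (forall i, edge_sum (hE K) (fun=> 1) z i <= lam * z i ^+ r.-1) ->
  is_eigenvalue R r K mu -> ComplexField.Normc.normc mu <= lam.
Proof.
move=> r0 K_unif z0 z_le [y [[i0 yi0] eig]].
pose a i := ComplexField.Normc.normc (y i).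
have aE i : `|y i| = ((a i)%:C)%C by [].
have a_ge0 i : 0 <= a i by rewrite -lecR -aE normr_ge0.
have a_le i : ComplexField.Normc.normc mu * a i ^+ r.-1 <= edge_sum (hE K) (fun=> 1) a i.
  rewrite -lecR.
  have -> : ((ComplexField.Normc.normc mu * a i ^+ r.-1)%:C)%C = `|mu * y i ^+ r.-1|.
    by rewrite normrM normrX rmorphM rmorphXn.
  rewrite -eig adj_tensor_sum // (le_trans (ler_norm_sum _ _ _)) // /edge_sum rmorph_sum.
  by apply: ler_sum => e _; rewrite !mul1r rmorph_prod normr_prod.
have unif e : e \in hE K -> #|e| = r.-1.+1 by move=> /K_unif ->; rewrite prednK.
have one_ge1 (e : {set hV K}) : e \in hE K -> (1 : R) <= (fun=> 1) e by [].
pose q i := a i / z i.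
case: (@Order.TotalTheory.arg_maxP _ R _ i0 xpredT q isT) => k _ kmax.
have a_qz j : a j <= q k * z j by rewrite -ler_pdivrMr //; exact: kmax.
have ak0 : 0 < a k.
  have : 0 < q i0.
    rewrite divr_gt0 // lt_neqAle a_ge0 andbT eq_sym.
    by apply: contra yi0 => /eqP/ComplexField.Normc.eq0_normc ->.
  move=> /lt_le_trans/(_ (kmax i0 isT)); rewrite /q pmulr_lgt0 ?invr_gt0 //.
have ler : ComplexField.Normc.normc mu * a k ^+ r.-1 <= lam * a k ^+ r.-1.
  apply: le_trans (a_le k) _.
  apply: le_trans (_ : edge_sum (hE K) (fun=> 1) (fun j => q k * z j) k <= _).
    by apply: ler_edge_sum => // j; rewrite a_ge0 a_qz.
  rewrite (edge_sumZ _ unif).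
  apply: le_trans (_ : q k ^+ r.-1 * (lam * z k ^+ r.-1) <= _).
    by rewrite ler_wpM2l // exprn_ge0 // divr_ge0 // ltW.
  by rewrite mulrCA -exprMn /q divfK // gt_eqF.
by move: ler; rewrite ler_pM2r // exprn_gt0.
Qed.

Lemma rho_eq (R : realType) r (K : hgraph) (z : hV K -> R) lam :
  (0 < r)%N -> uniform r K -> 0 <= lam -> (forall i, 0 < z i) ->
  (forall i, edge_sum (hE K) (fun=> 1) z i <= lam * z i ^+ r.-1) ->
  is_eigenvalue R r K (lam%:C)%C -> rho R r K = lam.
Proof.
move=> r0 K_unif lam0 z0 z_le eig; rewrite /rho; set S := (fun y : R => _).
have Slam : S lam.
  by exists (lam%:C)%C => //; rewrite /= expr0n addr0 sqrtr_sqr ger0_norm.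
have S_ub : ubound S lam.
  by move=> _ [mu mu_eig <-]; exact: eigenvalue_le mu_eig.
apply/eqP; rewrite eq_le; apply/andP; split.
  by apply: ge_sup => //; exists lam.
by apply: ub_le_sup => //; exists lam.
Qed.

(** * The tensor on a coalescence *)

Section EdgeSum.
Variable A : comPzRingType.

Lemma edge_sum_imset (V W : finType) (h : V -> W) (E : {set {set V}}) c (x : W -> A) i :
  injective h ->
  edge_sum [set h @: e | e : {set V} in E] c x (h i) =
  edge_sum E (fun e => c (h @: e)) (x \o h) i.
Proof.
move=> hI; rewrite /edge_sum big_imset_cond /=; last by move=> e f _ _; apply: imset_inj.
apply: eq_big => [e|e _]; first by rewrite mem_imset.
congr (_ * _).
have -> : (h @: e) :\ h i = h @: (e :\ i).
  apply/setP => w; rewrite !inE; apply/andP/imsetP.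
    case=> wi /imsetP[y ye wy]; exists y => //; rewrite !inE ye andbT.
    by apply: contraNneq wi => <-; rewrite wy.
  by case=> y /setD1P[yi ye] ->; rewrite (inj_eq hI) imset_f.
by rewrite big_imset // => y z _ _; apply: hI.
Qed.

Lemma eq_edge_sum (V : finType) (E F : {set {set V}}) (c d : {set V} -> A) (x y : V -> A) i :
  (forall e : {set V}, i \in e -> (e \in E) = (e \in F)) ->
  (forall e : {set V}, e \in E -> i \in e -> c e = d e) -> x =1 y ->
  edge_sum E c x i = edge_sum F d y i.
Proof.
move=> EF cd xy; apply: eq_big => [e|e /andP[eE ie]].
  by apply: andb_id2r => /EF.
by rewrite cd //; congr (_ * _); apply: eq_bigr => j _.
Qed.

Lemma edge_sum0 (V : finType) (E : {set {set V}}) c (x : V -> A) i :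
  (forall e : {set V}, e \in E -> i \notin e) -> edge_sum E c x i = 0.
Proof. by move=> Ei; apply: big1 => e /andP[/Ei/negbTE->]. Qed.

Lemma edge_sumU (V : finType) (E F : {set {set V}}) c (x : V -> A) i :
  [disjoint E & F] ->
  edge_sum (E :|: F) c x i = edge_sum E c x i + edge_sum F c x i.
Proof.
move=> EF; rewrite /edge_sum !big_mkcondr -bigU //=.
by apply: eq_bigl => e; rewrite !inE.
Qed.

End EdgeSum.

Section CoalEdgeSum.
Variables (A : comPzRingType) (r m : nat) (G H : hgraph) (u : hV G) (v : hV H).
Local Notation K := (coal r G u m H v).
Local Notation coal_l := (@coal_l r m G H u v).
Local Notation coal_r := (@coal_r r m G H u v).
Local Notation coal_mid := (@coal_mid r m G H u v).
Local Notation join_edge := (@join_edge r m G H u v).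

(** Serves two uses: weight m^(1/r) on a single join edge, where [perron] is applied, and weight 1
    on [m] join edges, where the result is transferred. *)
Definition join_weight (k : A) (e : {set hV K}) : A :=
  if e \in [set join_edge i | i : 'I_m] then k else 1.

Lemma prod_join_edge (f : hV K -> A) i :
  \prod_(y in join_edge i) f y =
  f (coal_l u) * (f (coal_r i v) * \prod_j f (coal_mid i j)).
Proof.
rewrite big_setU1 /=; last first.
  by rewrite in_setU1 /=; apply/imsetP => -[].
rewrite big_setU1 /=; last by apply/imsetP => -[].
by rewrite big_imset //= => j k _ _ [].
Qed.

(** Deleting a vertex becomes replacing its value by 1, so [prod_join_edge] evaluates the product
    whichever vertex is deleted. *)
Lemma prod_join_edgeD1 (f : hV K -> A) i a :
  \prod_(y in join_edge i :\ a) f y =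
  \prod_(y in join_edge i) if y != a then f y else 1.
Proof. by rewrite -big_mkcondr; apply: eq_bigl => y; rewrite in_setD1 andbC. Qed.

Lemma edge_sum_join_l k (x : hV K -> A) g :
  edge_sum [set join_edge i | i : 'I_m] (join_weight k) x (coal_l g) =
  (g == u)%:R * k * \sum_i (x (coal_r i v) * \prod_j x (coal_mid i j)).
Proof.
rewrite /edge_sum big_imset_cond /=; last by move=> i j _ _; apply: join_edge_inj.
under eq_bigl do rewrite join_edge_l.
case: eqP => [->|_]; last by rewrite big_pred0_eq !mul0r.
rewrite mul1r mulr_sumr; apply: eq_bigr => i _.
rewrite /join_weight imset_f // prod_join_edgeD1 prod_join_edge eqxx mul1r.
by congr (_ * _).
Qed.

Lemma edge_sum_join_r k (x : hV K -> A) i h :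
  edge_sum [set join_edge i | i : 'I_m] (join_weight k) x (coal_r i h) =
  (h == v)%:R * k * (x (coal_l u) * \prod_j x (coal_mid i j)).
Proof.
rewrite /edge_sum big_imset_cond /=; last by move=> i' j _ _; apply: join_edge_inj.
under eq_bigl do rewrite join_edge_r.
case: eqP => [->|_]; last by rewrite big_pred0 ?mul0r // => j; rewrite !andbF.
rewrite mul1r (big_pred1 i) => [|j]; last by rewrite andbT eq_sym.
rewrite /join_weight imset_f // prod_join_edgeD1 prod_join_edge eqxx /= mul1r.
by congr (_ * (_ * _)).
Qed.

Lemma edge_sum_join_mid k (x : hV K -> A) i j :
  edge_sum [set join_edge i | i : 'I_m] (join_weight k) x (coal_mid i j) =
  k * (x (coal_l u) * (x (coal_r i v) * \prod_(j' | j' != j) x (coal_mid i j'))).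
Proof.
rewrite /edge_sum big_imset_cond /=; last by move=> i' j' _ _; apply: join_edge_inj.
under eq_bigl do rewrite join_edge_mid.
rewrite (big_pred1 i) => [|j']; last by rewrite eq_sym.
rewrite /join_weight imset_f // prod_join_edgeD1 prod_join_edge /=.
congr (_ * (_ * (_ * _))); rewrite [RHS]big_mkcond; apply: eq_bigr => j' _.
by rewrite (inj_eq (_ : injective (coal_mid i))) // => a b [].
Qed.

Lemma join_weight1 e : join_weight 1 e = 1.
Proof. by rewrite /join_weight if_same. Qed.

Lemma edge_sum_coal k (x : hV K -> A) w :
  edge_sum (hE K) (join_weight k) x w =
  match w with
  | inl g => edge_sum (hE G) (fun=> 1) (x \o coal_l) g
  | inr (inl (i, h)) => edge_sum (hE H) (fun=> 1) (x \o coal_r i) h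
  | _ => 0
  end + edge_sum [set join_edge i | i : 'I_m] (join_weight k) x w.
Proof.
rewrite coal_edges edge_sumU; last exact: disjoint_edges_join.
have nojoin e : e \in [set coal_l @: e | e : {set hV G} in hE G] :|:
   \bigcup_i [set coal_r i @: e | e : {set hV H} in hE H] -> join_weight k e = 1.
  move=> eK; rewrite /join_weight.
  by rewrite (disjointFr _ eK) //; exact: disjoint_edges_join.
congr (_ + _); case: w => [g|[[i h]|[i j]]].
- rewrite -[RHS](@edge_sum_imset _ _ _ coal_l _ (fun=> 1)); last exact: coal_l_inj.
  apply: eq_edge_sum => // [e ge|e eE _]; last exact: nojoin.
  rewrite in_setU orbC; case: bigcupP => // -[i _ /imsetP[f _ ef]].
  by move: ge; rewrite ef => /imsetP[].
- rewrite -[RHS](@edge_sum_imset _ _ _ (coal_r i) _ (fun=> 1)); last by move=> a b [].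
  apply: eq_edge_sum => // [e ge|e eE _]; last exact: nojoin.
  rewrite in_setU; case: imsetP => [[f _ ef]|_] /=.
    by move: ge; rewrite ef => /imsetP[].
  apply/bigcupP/idP => [[k' _ /[dup] + /imsetP[f _ ef]]|]; last by exists i.
  by move: ge; rewrite ef => /imsetP[a _ []] ->.
- apply: edge_sum0 => e; rewrite in_setU; apply: contraTN => ie; apply/negP.
  case/orP => [/imsetP[f _ ef]|/bigcupP[k' _ /imsetP[f _ ef]]];
    by move: ie; rewrite ef => /imsetP[].
Qed.

End CoalEdgeSum.

(** * Uniformity and connectedness of the constructions *)

Lemma card_join_edge r m (G H : hgraph) (u : hV G) (v : hV H) (i : 'I_m) :
  (1 < r)%N -> #|@join_edge r m G H u v i| = r.
Proof.
move=> r1; rewrite cardsU1 cardsU1 card_imset; last by move=> a b [].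
rewrite in_setU1 /= [_ \in imset _ _](introF imsetP); last by case.
rewrite [_ \in imset _ _](introF imsetP); last by case.
by rewrite card_ord /= !add1n -addn2 subnK.
Qed.

Lemma coal_uniform r m (G H : hgraph) (u : hV G) (v : hV H) :
  (1 < r)%N -> uniform r G -> uniform r H -> uniform r (coal r G u m H v).
Proof.
move=> r1 Gu Hu e; rewrite coal_edges !in_setU.
case/orP => [/orP[/imsetP[f fG ->]|/bigcupP[i _ /imsetP[f fH ->]]]|/imsetP[i _ ->]].
- by rewrite card_imset ?Gu //; exact: coal_l_inj.
- by rewrite card_imset ?Hu // => a b [].
exact: card_join_edge.
Qed.

Lemma connect_homo (V W : finType) (e : rel V) (e' : rel W) (h : V -> W) :
  {homo h : x y / e x y >-> e' x y} -> {homo h : x y / connect e x y >-> connect e' x y}.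
Proof.
move=> he x y /connectP[p pth ->]; apply/connectP; exists (map h p).
  by apply: homo_path pth => a b; apply: he.
by rewrite last_map.
Qed.

Lemma hadj_imset (K L : hgraph) (h : hV K -> hV L) :
  (forall e, e \in hE K -> h @: e \in hE L) -> {homo h : x y / hadj K x y >-> hadj L x y}.
Proof.
move=> hE x y /exists_inP[e eE /andP[xe ye]]; apply/exists_inP.
by exists (h @: e); rewrite ?hE ?imset_f.
Qed.

Lemma coal_connected r m (G H : hgraph) (u : hV G) (v : hV H) :
  hconnected G -> hconnected H -> hconnected (coal r G u m H v).
Proof.
move=> Gc Hc; set K := coal r G u m H v.
have Ksym : connect_sym (hadj K).
  apply: sym_connect_sym => x y; apply: eq_existsb => e.
  by rewrite [(x \in e) && _]andbC.
have join_adj i a b : a \in @join_edge r m G H u v i -> b \in @join_edge r m G H u v i ->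
    connect (hadj K) a b.
  move=> ai bi; apply: connect1; apply/exists_inP; exists (join_edge r u v i).
    by rewrite coal_edges in_setU imset_f ?orbT.
  by rewrite ai bi.
suff to_u w : connect (hadj K) w (coal_l r m u v u).
  by move=> x y; apply: connect_trans (to_u x) _; rewrite Ksym.
case: w => [g|[[i h]|[i j]]].
- apply: (connect_homo (e := hadj G) (h := coal_l r m u v)) (Gc g u).
  apply: hadj_imset => e eG.
  by rewrite coal_edges !in_setU imset_f.
- apply: connect_trans (_ : connect (hadj K) (coal_r r u v i v) _).
    apply: (connect_homo (e := hadj H) (h := coal_r r u v i)) (Hc h v).
    apply: hadj_imset => e eH; rewrite coal_edges !in_setU.
    by rewrite [X in _ || X || _](introT bigcupP) ?orbT //; exists i; rewrite ?imset_f.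
  by apply: (join_adj i); rewrite ?join_edge_l ?join_edge_r ?eqxx.
by apply: (join_adj i); rewrite ?join_edge_l ?(join_edge_mid _ _ i) ?eqxx.
Qed.

Lemma hunion_uniform r (K L : hgraph) :
  uniform r K -> uniform r L -> uniform r (hunion K L).
Proof.
move=> Ku Lu e /setUP[] /imsetP[f fE ->]; rewrite card_imset ?Ku ?Lu //.
  by move=> a b [].
by move=> a b [].
Qed.

Lemma hcopies_uniform r k (K : hgraph) : uniform r K -> uniform r (hcopies k K).
Proof.
by move=> Ku e /imset2P[i f _ fE ->]; rewrite card_imset ?Ku // => a b [].
Qed.

(** * Spectral radius of a union with copies *)

Lemma edge_sum_hunion_l (A : comPzRingType) (K L : hgraph) (x : hV (hunion K L) -> A) i :
  edge_sum (hE (hunion K L)) (fun=> 1) x (inl i) = edge_sum (hE K) (fun=> 1) (x \o inl) i.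
Proof.
rewrite -(@edge_sum_imset _ _ _ inl _ (fun=> 1)); last by move=> a b [].
apply: eq_edge_sum => // e ie; rewrite in_setU orbC; case: imsetP => // -[f _ ef].
by move: ie; rewrite ef => /imsetP[].
Qed.

Lemma edge_sum_hunion_r (A : comPzRingType) (K L : hgraph) (x : hV (hunion K L) -> A) i :
  edge_sum (hE (hunion K L)) (fun=> 1) x (inr i) = edge_sum (hE L) (fun=> 1) (x \o inr) i.
Proof.
rewrite -(@edge_sum_imset _ _ _ inr _ (fun=> 1)); last by move=> a b [].
apply: eq_edge_sum => // e ie; rewrite in_setU; case: imsetP => // -[f _ ef].
by move: ie; rewrite ef => /imsetP[].
Qed.

Lemma edge_sum_hcopies (A : comPzRingType) k (K : hgraph) (x : hV (hcopies k K) -> A) i a :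
  edge_sum (hE (hcopies k K)) (fun=> 1) x (i, a) =
  edge_sum (hE K) (fun=> 1) (fun b => x (i, b)) a.
Proof.
rewrite -[RHS](@edge_sum_imset _ _ (hV (hcopies k K)) (pair i) _ (fun=> 1) x);
  last by move=> b c [].
apply: eq_edge_sum => // e ie; apply/imset2P/imsetP => [[j f _ fE ef]|[f fE ->]].
  by move: ie; rewrite ef => /imsetP[b _ [-> _]]; exists f.
by exists i f.
Qed.

(** [rho_eq] takes one vector for the upper bound and may take another for the eigenvalue. The
    positive vector [zx] only satisfies inequalities on the copies; [z'] is an eigenvector but
    vanishes there. *)
Lemma rho_hunion_hcopies (R : realType) r k (K G : hgraph)
    (z : hV K -> R) (x : hV G -> R) lam (i0 : hV K) :
  (1 < r)%N -> uniform r K -> uniform r G -> 0 <= lam ->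
  (forall i, 0 < z i) -> (forall i, edge_sum (hE K) (fun=> 1) z i = lam * z i ^+ r.-1) ->
  (forall i, 0 < x i) -> (forall i, edge_sum (hE G) (fun=> 1) x i <= lam * x i ^+ r.-1) ->
  rho R r (hunion K (hcopies k G)) = lam.
Proof.
move=> r1 Ku Gu lam0 z0 z_eig x0 x_le; have r0 : (0 < r)%N by apply: ltnW.
have Uu : uniform r (hunion K (hcopies k G)).
  by apply: hunion_uniform => //; apply: hcopies_uniform.
pose zx (w : hV (hunion K (hcopies k G))) : R :=
  match w with inl i => z i | inr (_, b) => x b end.
apply: (rho_eq (z := zx)) => //.
- by case=> [i|[j b]]; [exact: z0|exact: x0].
- case=> [i|[j b]]; first by rewrite edge_sum_hunion_l z_eig.
  by rewrite edge_sum_hunion_r edge_sum_hcopies.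
pose z' (w : hV (hunion K (hcopies k G))) : R := if w is inl i then z i else 0.
apply: (eigenvalue_real (x := z') (i0 := inl i0)) => //; first by rewrite /z' gt_eqF ?z0.
case=> [i|[j b]]; first by rewrite edge_sum_hunion_l z_eig.
(* On a copy both sides vanish: the exponent [r.-1] is positive, and every edge through [b] has a
   second vertex, where [z'] is 0. *)
rewrite edge_sum_hunion_r edge_sum_hcopies expr0n -subn1 subn_eq0 leqNgt r1 mulr0.
apply: big1 => e /andP[eE be]; have := cardsD1 b e; rewrite be (Gu e eE) add1n => re.
have /set0Pn[c ce] : e :\ b != set0 by rewrite -card_gt0 -ltnS -re.
by rewrite (bigD1 c) //= mul0r mulr0.
Qed.

(** * Eigenvectors shared by the two coalescences *)

(* The eigenvalue equations of G_u . 1 H_v with join edge of weight k, for a vector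
   taking the same value w at all the new vertices. *)
Definition balanced (R : realType) r (G H : hgraph) (u : hV G) (v : hV H) (k lam : R)
    (x : hV G -> R) (y : hV H -> R) (w : R) : Prop :=
  [/\ forall g, edge_sum (hE G) (fun=> 1) x g + (g == u)%:R * k * (y v * w ^+ (r - 2))
        = lam * x g ^+ r.-1,
      forall h, edge_sum (hE H) (fun=> 1) y h + (h == v)%:R * k * (x u * w ^+ (r - 2))
        = lam * y h ^+ r.-1 &
      k * (x u * (y v * w ^+ (r - 3))) = lam * w ^+ r.-1].

Lemma balanced_sym (R : realType) r (G H : hgraph) (u : hV G) (v : hV H) (k lam : R) x y w :
  balanced r u v k lam x y w -> balanced r v u k lam y x w.
Proof. by case=> bG bH bw; split=> //; rewrite -bw [y v * _]mulrCA. Qed.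

(** The vector comes from [perron] with one join edge of weight [k]. What remains is that it takes
    equal values at the new vertices. *)
Lemma balanced_exists (R : realType) r (G H : hgraph) (u : hV G) (v : hV H) (k : R) :
  (2 < r)%N -> uniform r G -> uniform r H -> hconnected G -> hconnected H -> 1 <= k ->
  exists lam x y w, [/\ 0 <= lam, forall g, 0 < x g, forall h, 0 < y h, 0 < w &
    balanced r u v k lam x y w].
Proof.
move=> r2 Gu Hu Gc Hc k1; pose K := coal r G u 1 H v.
have r1 : (1 < r)%N by apply: ltnW.
have Ku e : e \in hE K -> #|e| = r.-1.+1.
  by move=> eK; rewrite prednK ?(ltnW r1) //; exact: coal_uniform eK.
have c1 e : e \in hE K -> 1 <= @join_weight R r 1 G H u v k e.
  by rewrite /join_weight; case: ifP.
have [lam [z [lam0 z0 z_eig]]] := perron c1 Ku (coal_connected Gc Hc) (coal_l r 1 u v u).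
pose x g := z (coal_l r 1 u v g); pose y h := z (coal_r r u v ord0 h).
pose w j := z (coal_mid u v ord0 j).
(* A new vertex exists because [2 < r]; its value will be [w]. *)
have j0 : 'I_(r - 2) by apply: (Ordinal (_ : 0 < r - 2)%N); rewrite subn_gt0.
have w_eq j : w j = w j0.
  (* Multiplying the equation at [j'] by [w j'] completes the product over the join edge, which does
     not depend on [j']. Since this product is positive, so is [lam], and positive [r]-th roots are
     unique. *)
  have eq_mid j' : k * (x u * (y v * \prod_l w l)) = lam * w j' ^+ r.
    rewrite (bigD1 j') //= -[in RHS](prednK (ltnW r1)) exprSr [RHS]mulrA.
    have e := z_eig (coal_mid u v ord0 j').
    rewrite edge_sum_coal edge_sum_join_mid add0r in e.
    by rewrite -[lam * _]e /x /y /w; ring.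
  have lam_gt0 : 0 < lam.
    have : 0 < k * (x u * (y v * \prod_l w l)).
      rewrite mulr_gt0 ?(lt_le_trans ltr01 k1) // mulr_gt0 ?z0 // mulr_gt0 ?z0 //.
      by apply: prodr_gt0 => l _; exact: z0.
    by rewrite (eq_mid j) pmulr_lgt0 // exprn_gt0 //; exact: z0.
  have : lam * w j ^+ r = lam * w j0 ^+ r by rewrite -!eq_mid.
  move/(mulfI (lt0r_neq0 lam_gt0))/eqP; rewrite eqrXn2 ?(ltnW r1) //; last 2 first.
  - exact/ltW/z0.
  - exact/ltW/z0.
  by move/eqP.
exists lam, x, y, (w j0); split=> //; [by move=> g; exact: z0|by move=> h; exact: z0|exact: z0|].
split=> [g|h|].
- have := z_eig (coal_l r 1 u v g); rewrite edge_sum_coal edge_sum_join_l big_ord1 => <-.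
  by rewrite (eq_bigr _ (fun j _ => w_eq j)) prodr_const card_ord.
- have := z_eig (coal_r r u v ord0 h); rewrite edge_sum_coal edge_sum_join_r => <-.
  by rewrite (eq_bigr _ (fun j _ => w_eq j)) prodr_const card_ord.
have := z_eig (coal_mid u v ord0 j0); rewrite edge_sum_coal edge_sum_join_mid add0r => <-.
by rewrite (eq_bigr _ (fun j _ => w_eq j)) prodr_const cardC1 card_ord -subnS.
Qed.

(** At [u] the [m] join edges contribute a factor [m = k^r], that is, the weight [k] times the
    [k^(r-1)] by which scaling [x] multiplies the other terms. At each copy of [v] and at the new
    vertices, the value [k * x u] supplies the weight [k]. *)
Lemma coal_eigenvector (R : realType) r m (G H : hgraph) (u : hV G) (v : hV H) (k lam : R) x y w :
  (2 < r)%N -> uniform r G -> k ^+ r = m%:R -> balanced r u v k lam x y w ->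
  forall i, let z := (fun i : hV (coal r G u m H v) => match i with
    | inl g => k * x g | inr (inl (_, h)) => y h | _ => w end) in
  edge_sum (hE (coal r G u m H v)) (fun=> 1) z i = lam * z i ^+ r.-1.
Proof.
move=> r2 Gu km [bG bH bw] i z.
have r0 : (0 < r)%N by apply: leq_trans r2.
rewrite (@eq_edge_sum _ _ _ (hE (coal r G u m H v)) _ (@join_weight R r m G H u v 1) _ z) //;
  last by move=> e _ _; rewrite join_weight1.
rewrite edge_sum_coal; case: i => [g|[[i h]|[i j]]].
- rewrite (edge_sum_join_l 1 z g).
  have Gu' e : e \in hE G -> #|e| = r.-1.+1 by move=> /Gu ->; rewrite prednK.
  rewrite (@eq_edge_sum _ _ _ (hE G) _ (fun=> 1) _ (fun g => k * x g)) // (edge_sumZ _ Gu').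
  rewrite /= sumr_const prodr_const !card_ord exprMn mulrCA -bG mulrDr; congr (_ + _).
  by rewrite -[_ *+ m]mulr_natr -km -[in k ^+ r](prednK r0) exprS; ring.
- rewrite (edge_sum_join_r 1 z i h) prodr_const card_ord /= -bH; congr (_ + _).
  by ring.
rewrite (edge_sum_join_mid 1 z i j) prodr_const cardC1 card_ord /= add0r -bw.
by rewrite -subnS; ring.
Qed.

(** Intermediate values of X^r - m on the interval from 1 to m. The bound [1 <= k] is what [perron]
    asks of a weight. *)
Lemma root_exists (R : realType) r m : (0 < r)%N -> (0 < m)%N ->
  exists2 k : R, 1 <= k & k ^+ r = m%:R.
Proof.
move=> r0 m0; pose p : {poly R} := 'X^r - m%:R%:P.
have m1 : 1 <= m%:R :> R by rewrite ler1n.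
have pE a : p.[a] = a ^+ r - m%:R by rewrite !hornerE.
have [||k k_in /rootP] := @poly_ivt R p 1 m%:R; first exact: m1.
  rewrite !pE expr1n subr_le0 m1 /= subr_ge0.
  by rewrite -(prednK r0) exprS ler_peMr ?exprn_ege1 // (le_trans ler01 m1).
rewrite pE => /subr0_eq km; exists k => //.
by case/andP: k_in.
Qed.

Lemma rho_coal (R : realType) r m (G H : hgraph) (u : hV G) (v : hV H) (k lam : R) x y w :
  (2 < r)%N -> uniform r G -> uniform r H -> 0 < k -> k ^+ r = m%:R -> 0 <= lam ->
  (forall g, 0 < x g) -> (forall h, 0 < y h) -> 0 < w -> balanced r u v k lam x y w ->
  rho R r (coal r G u m H v) = lam /\
  forall n, rho R r (hunion (coal r G u m H v) (hcopies n G)) = lam.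
Proof.
move=> r2 Gu Hu k0 km lam0 x0 y0 w0 bal.
have r1 : (1 < r)%N by apply: ltnW.
have Ku : uniform r (coal r G u m H v) by apply: coal_uniform.
pose z := (fun i : hV (coal r G u m H v) => match i with
    | inl g => k * x g | inr (inl (_, h)) => y h | _ => w end).
have z0 i : 0 < z i.
  by case: i => [g|[[i h]|[i j]]]; [apply: mulr_gt0|apply: y0|].
have z_eig : forall i, edge_sum (hE (coal r G u m H v)) (fun=> 1) z i = lam * z i ^+ r.-1.
  by move=> i; exact: coal_eigenvector.
split=> [|n].
  apply: (rho_eq (z := z)) => //; first exact: ltnW.
    by move=> i; rewrite z_eig.
  apply: (eigenvalue_real (x := z) (i0 := coal_l r m u v u)) => //; first exact: ltnW.
  by rewrite gt_eqF.
apply: (@rho_hunion_hcopies _ _ _ _ _ z x lam (coal_l r m u v u)) => //.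
(* Dropping the nonnegative join term from the equation on [G] leaves the inequality needed on the
   copies of [G]. *)
case: bal => bG _ _ g; rewrite -bG lerDl; apply: mulr_ge0; last first.
  by rewrite mulr_ge0 ?exprn_ge0 // ltW.
by rewrite mulr_ge0 ?ler0n // ltW.
Qed.

Lemma uniform_set0 r (K : hgraph) : (0 < r)%N -> uniform r K -> set0 \notin hE K.
Proof. by move=> r0 Ku; apply: contraL r0 => /Ku <-; rewrite cards0. Qed.

Theorem theorem6 (R : realType) (m r : nat) (G H : hgraph) (u : hV G) (v : hV H) :
  (0 < m)%N -> (3 <= r)%N -> supertree r G -> supertree r H ->
  [/\ rho R r (hunion (coal r G u m H v) (hcopies m.-1 G))
        = rho R r (hunion (coal r H v m G u) (hcopies m.-1 H)),
      rho R r (coal r G u m H v) = rho R r (coal r H v m G u) &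
      ME R r (hunion (coal r G u m H v) (hcopies m.-1 G))
        = ME R r (hunion (coal r H v m G u) (hcopies m.-1 H))].
Proof.
move=> m0 r2 [Gu Gc _] [Hu Hc _].
have r0 : (0 < r)%N by apply: leq_trans r2.
have [k k1 km] := root_exists R r0 m0.
have k0 : 0 < k by apply: lt_le_trans k1.
have [lam [x [y [w [lam0 x0 y0 w0 bal]]]]] := balanced_exists u v r2 Gu Hu Gc Hc k1.
have [rhoG rhoGU] := rho_coal r2 Gu Hu k0 km lam0 x0 y0 w0 bal.
(* The same [lam], [x], [y] and [w] serve the other coalescence, so all four radii equal [lam]. *)
have [rhoH rhoHU] := rho_coal r2 Hu Gu k0 km lam0 y0 x0 w0 (balanced_sym bal).
split; rewrite ?rhoG ?rhoH ?rhoGU ?rhoHU //.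
by rewrite /ME matchpoly_swap // (uniform_set0 r0).
Qed.
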